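(* For all metric measure spaces $\mathcal{X}_1,\mathcal{X}_2$, $$ d_{\mathrm{GP}}(\mathcal{X}_1,\mathcal{X}_2) = \tfrac12\, \underline{\Box}_{1/2}(\mathcal{X}_1,\mathcal{X}_2), $$ where $d_{\mathrm{GP}}$ is the Gromov-Prohorov metric and $\underline{\Box}_{1/2}$ is Gromov's metric $\underline{\Box}_\lambda$ with parameter $\lambda=\tfrac12$.
   Context: A metric measure space (mm-space) is a triple $\mathcal{X}=(X,d,\mu)$ where $(X,d)$ is a complete separable metric space and $\mu$ is a probability measure on the Borel $\sigma$-algebra of $X$. Two mm-spaces $(X,d,\mu)$ and $(X',d',\mu')$ are isomorphic (and are not distinguished) if there is a measure preserving map $f\colon X\to X'$ (i.e. $\mu'=\mu\circ f^{-1}$) with $d(x,y)=d'(f(x),f(y))$ for all $x,y\in\mathrm{supp}(\mu)$. Prohorov distance: for probability measures $\mu,\nu$ on a metric space $(X,d)$, $d_{\mathrm{Pr}}(\mu,\nu)=\inf\{\varepsilon>0 : \mu(A)\le \nu(A^\varepsilon)+\varepsilon \text{ for all Borel } A\subseteq X\}$, where $A^\varepsilon=\{x\in X: d(A,x)<\varepsilon\}$. Gromov-Prohorov metric: for mm-spaces $\mathcal{X}_i=(X_i,d_i,\mu_i)$, $i=1,2$, $d_{\mathrm{GP}}(\mathcal{X}_1,\mathcal{X}_2)=\inf_{f,g} d_{\mathrm{Pr}}(\mu_1\circ f^{-1},\mu_2\circ g^{-1})$, where the infimum is over all isometries (isometric embeddings) $f\colon X_1\to X$, $g\colon X_2\to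 X$ into a common separable metric space $(X,d)$. Metric $\Box_\lambda$ ($\lambda>0$): for a probability space $(X,\mathfrak{B},\mu)$ and functions $r,s\colon X\times X\to\mathbb{R}$, $\Box_\lambda(r,s)=\inf\{\varepsilon>0 : \exists X_\varepsilon\in\mathfrak{B} \text{ with } \sup_{x,y\in X_\varepsilon}|r(x,y)-s(x,y)|\le\varepsilon \text{ and } \mu(X\setminus X_\varepsilon)\le\lambda\varepsilon\}$. Gromov's metric $\underline{\Box}_\lambda$: let $I=[0,1]$ with Lebesgue measure. For an mm-space $\mathcal{X}=(X,d,\mu)$ let $\mathcal{F}(\mathcal{X})$ be the (non-empty) set of measure preserving maps $\varphi\colon I\to X$ (parametrisations), and $d_\varphi(s,t)=d(\varphi(s),\varphi(t))$ for $s,t\in I$. Then $\underline{\Box}_\lambda(\mathcal{X},\mathcal{X}')=\inf_{\varphi\in\mathcal{F}(\mathcal{X}),\,\varphi'\in\mathcal{F}(\mathcal{X}')}\Box_\lambda(d_\varphi,d'_{\varphi'})$, where $\Box_\lambda$ is taken on $I$ with Lebesgue measure. *)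

(* Defs.v *)
From HB Require Import structures.
From mathcomp Require Import all_boot all_order all_algebra.
From mathcomp Require Import all_classical all_reals all_analysis.

Set Implicit Arguments.
Unset Strict Implicit.
Unset Printing Implicit Defensive.

Import Order.TTheory GRing.Theory Num.Theory.
Import numFieldNormedType.Exports.

Local Open Scope classical_set_scope.
Local Open Scope ring_scope.

(* All infima are taken in the extended reals, where [ereal_inf set0 = +oo];
   this avoids the convention [inf set0 = 0] of the real-valued [inf].
   A [measurableType] is pointed; asking metric spaces to be pointed only
   excludes the empty space, which carries no probability measure. *)

#[short(type="pmetricType")]
HB.structure Definition PointedMetric (R : numDomainType) :=
  {T of PseudoPointedMetric R T & Metric R T}.

#[short(type="completeMetricType")]
HB.structure Definition CompleteMetric (R : numDomainType) :=
  {T of Complete T & PointedMetric R T}.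

Definition borel (T : ptopologicalType) : measurableType (@open T).-sigma :=
  g_sigma_algebraType (@open T).

Definition separable (T : topologicalType) : Prop :=
  exists D : set T, countable D /\ dense D.

Definition isometric (R : numDomainType) (X Y : metricType R)
    (f : X -> Y) : Prop :=
  forall x y, mdist (f x) (f y) = mdist x y.

Record mmspace (R : realType) := MMSpace {
  mm_carrier :> completeMetricType R ;
  mm_separable : separable mm_carrier ;
  mm_measure : probability (borel mm_carrier) R
}.

Definition thicken (R : realType) (T : metricType R) (A : set T) (e : R) :
    set T :=
  [set x | (ereal_inf [set (mdist a x)%:E | a in A] < e%:E)%E].

(* Stated for set functions so that it applies to [pushforward]; it is only
   used on probability measures. *)
Definition prohorov (R : realType) (T : pmetricType R)
    (mu nu : set (borel T) -> \bar R) : \bar R :=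
  ereal_inf [set e%:E | e in [set e : R | 0 < e /\
    forall A : set (borel T), measurable A ->
      (mu A <= nu (thicken A e) + e%:E)%E]].

Definition gromov_prohorov (R : realType) (X1 X2 : mmspace R) : \bar R :=
  ereal_inf [set v | exists (Z : pmetricType R) (f : X1 -> Z) (g : X2 -> Z),
    [/\ separable Z, isometric f, isometric g &
      v = prohorov (pushforward (mm_measure X1) (f : borel X1 -> borel Z))
                   (pushforward (mm_measure X2) (g : borel X2 -> borel Z))]].

Definition box (R : realType) (d : measure_display) (T : measurableType d)
    (P : probability T R) (lambda : R) (r s : T -> T -> R) : \bar R :=
  ereal_inf [set e%:E | e in [set e : R | 0 < e /\
    exists A : set T, [/\ measurable A,
      (ereal_sup [set `|r x y - s x y|%:E | x in A & y in A] <= e%:E)%E &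
      (P (~` A) <= (lambda * e)%:E)%E]]].

(* The probability space [0, 1]: the subtype of R with the trace of the Borel
   sigma-algebra and the restriction of Lebesgue measure. *)
Section unit_interval.
Variable R : realType.

Definition unitI : Type := {x : R | x \in `[0, 1]}.

HB.instance Definition _ := Choice.on unitI.

Lemma unitI0_subproof : (0 : R) \in `[0, 1].
Proof. by rewrite in_itv /= lexx ler01. Qed.

HB.instance Definition _ :=
  isPointed.Build unitI (exist _ 0 unitI0_subproof).

Definition unitI_val (x : unitI) : measurableTypeR R := val x.

Definition unit_interval := g_sigma_algebra_preimageType unitI_val.

HB.instance Definition _ := Measurable.on unit_interval.

Definition lebesgueI (A : set unit_interval) : \bar R :=
  lebesgue_measure (unitI_val @` A).

Lemma image_unitI_val (B : set R) :
  unitI_val @` (unitI_val @^-1` B) = B `&` `[0, 1].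
Proof.
apply/seteqP; split => [_ [x Bx <-]|x [Bx x01]]; first by split => //; exact: (valP x).
by exists (exist _ x x01).
Qed.

Lemma measurable_image_unitI (A : set unit_interval) :
  measurable A -> measurable (unitI_val @` A).
Proof.
move=> [B mB <-]; rewrite setTI image_unitI_val.
by apply: measurableI => //; exact: measurable_itv.
Qed.

Let lebesgueI0 : lebesgueI set0 = 0%E.
Proof. by rewrite /lebesgueI image_set0 measure0. Qed.

Let lebesgueI_ge0 A : (0 <= lebesgueI A)%E.
Proof. exact: measure_ge0. Qed.

Let lebesgueI_sigma_additive : semi_sigma_additive lebesgueI.
Proof.
move=> F mF tF mUF; rewrite /lebesgueI image_bigcup.
apply: measure_semi_sigma_additive.
- by move=> n; exact: measurable_image_unitI.
- apply/trivIsetP => i j _ _ ij; rewrite -subset0 => _ [[x Fx <-] [y Fy yx]].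
  have /trivIsetP/(_ i j I I ij) := tF; rewrite -subset0 => /(_ x); apply.
  by split => //; rewrite -(val_inj yx).
- by rewrite -image_bigcup; exact: measurable_image_unitI.
Qed.

HB.instance Definition _ := isMeasure.Build _ _ _ lebesgueI
  lebesgueI0 lebesgueI_ge0 lebesgueI_sigma_additive.

Let lebesgueI_setT : lebesgueI setT = 1%E.
Proof.
rewrite /lebesgueI -(preimage_setT unitI_val) image_unitI_val setTI.
by rewrite lebesgue_measure_itv /= lte_fin ltr01 oppr0 adde0.
Qed.

HB.instance Definition _ :=
  Measure_isProbability.Build _ _ _ lebesgueI lebesgueI_setT.

End unit_interval.

Definition parametrisation (R : realType) (X : mmspace R)
    (phi : unit_interval R -> borel X) : Prop :=
  measurable_fun setT phi /\
  forall A, measurable A -> pushforward (@lebesgueI R) phi A = mm_measure X A.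

Definition pullback_dist (R : realType) (I : Type) (X : metricType R)
    (phi : I -> X) (s t : I) : R :=
  mdist (phi s) (phi t).

Definition gromov_box (R : realType) (lambda : R) (X1 X2 : mmspace R) :
    \bar R :=
  ereal_inf [set v | exists (phi1 : unit_interval R -> X1)
                            (phi2 : unit_interval R -> X2),
    [/\ parametrisation phi1, parametrisation phi2 &
      v = box (@lebesgueI R) lambda (pullback_dist phi1) (pullback_dist phi2)]].

(* Main.v *)
From HB Require Import structures.
Require Import Defs.
From mathcomp Require Import all_boot all_order all_algebra.
From mathcomp Require Import all_classical all_reals all_analysis.
From mathcomp Require Import measurable_realfun ring lra.

Set Implicit Arguments.
Unset Strict Implicit.
Unset Printing Implicit Defensive.

Import Order.TTheory GRing.Theory Num.Theory.
Import numFieldNormedType.Exports.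

Local Open Scope ring_scope.

(** Two inequalities, each proved by turning a witness for one side into a
    witness for the other.

    Upper bound on the Gromov-Prohorov distance. Let [phi1], [phi2] be
    parametrisations whose pulled back distances differ by at most [2 * h] on a
    set [A] with complement of measure at most [h]. On the disjoint union of the
    two spaces, put a bridge of length [h] between [phi1 s] and [phi2 s] for
    every [s] in [A], and let the distance of two points on different sides be
    the infimum of the lengths of the paths over one bridge. The bound [2 * h] on the
    distortion says exactly that a detour over two bridges is never a shortcut,
    so both spaces embed isometrically ([glued_space]). In the glued space
    [phi1] and [phi2] are [h]-close on [A], hence the two image measures are at
    Prohorov distance at most [h] ([gromov_prohorov_le]).

    Upper bound on the box distance. Given isometric embeddings [f], [g] for
    which the Prohorov inequality holds with [e], it suffices to find
    parametrisations for which [f \o phi1] and [g \o phi2] are nearly [e]-close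
    off a set of measure nearly [e]: the triangle inequality then bounds the
    distortion by twice that, and [e] is one half of [2 * e], whence the value
    [1/2] of the parameter. This is an approximate form of Strassen's theorem
    ([approximate_strassen]). Both spaces are cut into finitely many Borel cells
    of small diameter, up to a small remainder. The Prohorov inequality becomes
    Hall's condition with a defect for the finite weights of the cells, so there
    is a matrix with the prescribed marginals and little mass on pairs of cells
    that are far apart ([fractional_hall], [deficient_transport]). Spreading
    each entry of the matrix as a product measure over the corresponding pair of
    cells gives a coupling of the two measures ([glue_marginals]).

    It remains to realise a probability measure [pi] on a product of two Polish
    spaces as the joint law of two maps on the unit interval
    ([joint_parametrisation]). A pair of points is determined by the sequence of
    answers to countably many questions: is the first (second) coordinate in the
    ball of radius [2^-n] around the [k]-th point of a dense sequence? These
    answers are written as digits in base 4 of one real number ([base4_code]);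
    the quantile function of the law of this number carries Lebesgue measure to
    that law ([quantile_transform]); and completeness allows the points to be
    recovered measurably from the digits ([decode]). *)

(** * Fractional matchings and finite transport *)

Section transport.
Variables (R : realFieldType).

Definition neighbours (I J : finType) (E : I -> J -> bool) (S : {set I}) :
  {set J} := [set j | [exists i in S, E i j]].

Lemma neighboursU (I J : finType) (E : I -> J -> bool) (S T : {set I}) :
  neighbours E (S :|: T) = neighbours E S :|: neighbours E T.
Proof.
apply/finset.setP => j; rewrite !inE; apply/exists_inP/orP.
  by move=> [i /finset.setUP[] iS Eij]; [left|right]; apply/exists_inP; exists i.
by case=> /exists_inP[i iS Eij]; exists i => //; rewrite inE iS ?orbT.
Qed.

Lemma neighboursS (I J : finType) (E : I -> J -> bool) (S T : {set I}) :
  S \subset T -> neighbours E S \subset neighbours E T.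
Proof. by move=> /finset.setUidPr <-; rewrite neighboursU finset.subsetUl. Qed.

Lemma sum_restrict (I : finType) (S T : {set I}) (a : I -> R) :
  \sum_(i in S) (if i \in T then a i else 0) = \sum_(i in S :&: T) a i.
Proof.
by rewrite -big_mkcondr; apply: eq_bigl => i; rewrite inE.
Qed.

Lemma sum_point (I : finType) (S : {set I}) (i0 : I) (t : R) :
  \sum_(i in S) (if i == i0 then t else 0) = if i0 \in S then t else 0.
Proof.
rewrite -big_mkcondr; case: ifP => i0S.
  rewrite (bigD1 i0) ?i0S ?eqxx//= big1 ?addr0// => i /andP[/andP[_ ->]].
  by [].
by rewrite big_pred0// => i; apply/andP => -[iS /eqP ii0]; rewrite -ii0 iS in i0S.
Qed.

Lemma sum_pointT (I : finType) (i0 : I) (t : R) :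
  \sum_i (if i == i0 then t else 0) = t.
Proof. by rewrite -big_mkcond big_pred1_eq. Qed.

Lemma subset_sum_le (I : finType) (S T : {set I}) (a : I -> R) :
  (forall i, 0 <= a i) -> S \subset T ->
  \sum_(i in S) a i <= \sum_(i in T) a i.
Proof.
move=> a0 ST; rewrite [leRHS](big_setID S)/= (finset.setIidPr ST) lerDl.
exact: sumr_ge0.
Qed.

Lemma card_support_le (I : finType) (a a' : I -> R) :
  (forall i, a i = 0 -> a' i = 0) ->
  (#|[set i | a' i != 0%R]| <= #|[set i | a i != 0%R]|)%N.
Proof.
move=> aa'; apply: subset_leq_card; apply/fintype.subsetP => i; rewrite !inE.
by apply: contra_neq; exact: aa'.
Qed.

Lemma card_support_lt (I : finType) (a a' : I -> R) (i0 : I) :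
  (forall i, a i = 0 -> a' i = 0) -> a i0 != 0 -> a' i0 = 0 ->
  (#|[set i | a' i != 0%R]| < #|[set i | a i != 0%R]|)%N.
Proof.
move=> aa' ai0 a'i0; apply: proper_card; apply/properP; split.
  by apply/fintype.subsetP => i; rewrite !inE; apply: contra_neq; exact: aa'.
by exists i0; rewrite inE ?ai0// a'i0 eqxx.
Qed.

(** Hall's marriage theorem for real weights, by induction on the total size of
    the supports. Choose an edge between two points of positive weight and ship
    as much mass [t] along it as Hall's condition permits. Either one endpoint
    is exhausted and a support shrinks, or some set [S] becomes tight; then the
    problem splits into the part inside [S] and its neighbours and the part
    outside, both of which satisfy Hall's condition and have smaller support. *)
Lemma fractional_hall (I J : finType) (E : I -> J -> bool)
    (a : I -> R) (b : J -> R) :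
  (forall i, 0 <= a i) -> (forall j, 0 <= b j) ->
  (forall S : {set I}, \sum_(i in S) a i <= \sum_(j in neighbours E S) b j) ->
  exists w : I -> J -> R, [/\ forall i j, 0 <= w i j,
    forall i j, ~~ E i j -> w i j = 0,
    forall i, \sum_j w i j = a i &
    forall j, \sum_i w i j <= b j].
Proof.
move: {2}(_ + _)%N
  (leqnn (#|[set i | a i != 0%R]| + #|[set j | b j != 0%R]|)) => n.
elim: n a b => [|n IHn] a b ltn a0 b0 hall.
  exists (fun _ _ => 0); split => // [i|j]; last by rewrite big1.
  rewrite big1//; apply/eqP; rewrite eq_sym; apply/negPn/negP => ai.
  move: ltn; rewrite leqn0 addn_eq0 => /andP[/eqP/cards0_eq/finset.setP/(_ i)].
  by rewrite !inE ai.
have [i0 ai0|a_eq0] := pickP (fun i => a i != 0); last first.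
  exists (fun _ _ => 0); split => // [i|j]; last by rewrite big1.
  by rewrite big1//; move/negbFE/eqP: (a_eq0 i) => ->.
(* A neighbour of positive weight exists by Hall's condition for [[set i0]]. *)
have [j0 /andP[Eij0 bj0]|b_eq0] := pickP (fun j => E i0 j && (b j != 0)); last first.
  move: (hall [set i0]); rewrite big_set1 big1 => [|j].
    by rewrite le_eqVlt (negbTE ai0)/= ltNge a0.
  rewrite inE => /exists_inP[i /set1P -> Eij].
  by move: (b_eq0 j); rewrite Eij/= => /negbFE/eqP.
pose cond (S : {set I}) := (i0 \notin S) && (j0 \in neighbours E S).
(* Sending mass from i0 to j0 reduces the slack in Hall's condition only for
   sets that have j0 as a neighbour but do not contain i0. *)
pose slack (S : {set I}) := \sum_(j in neighbours E S) b j - \sum_(i in S) a i.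
have [t [t0 ta tb tS tE]] : exists t, [/\ 0 <= t, t <= a i0, t <= b j0,
    forall S, cond S -> t <= slack S &
    [\/ t = a i0, t = b j0 | exists2 S, cond S & t = slack S]].
  exists (\big[Num.min/Num.min (a i0) (b j0)]_(S | cond S) slack S).
  have h : \big[Num.min/Num.min (a i0) (b j0)]_(S | cond S) slack S
      <= Num.min (a i0) (b j0) by exact: bigmin_le_id.
  split.
  - apply: (big_ind (fun x => 0 <= x)) => [|x y x0 y0|S _].
    + by rewrite le_min a0 b0.
    + by rewrite le_min x0.
    + by rewrite subr_ge0.
  - by rewrite (le_trans h)// ge_min lexx.
  - by rewrite (le_trans h)// ge_min lexx orbT.
  - by move=> S condS; exact: bigmin_le_cond.
  - apply: (big_ind (fun x =>
      [\/ x = a i0, x = b j0 | exists2 S, cond S & x = slack S])) => [|x y hx hy|S cS].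
    + by rewrite minElt; case: ifP => _; [constructor 1|constructor 2].
    + by rewrite minElt; case: ifP.
    + by constructor 3; exists S.
pose a' i := a i - (if i == i0 then t else 0).
pose b' j := b j - (if j == j0 then t else 0).
have a'0 i : 0 <= a' i.
  by rewrite /a'; case: eqP => [->|_]; rewrite ?subr0// subr_ge0.
have b'0 j : 0 <= b' j.
  by rewrite /b'; case: eqP => [->|_]; rewrite ?subr0// subr_ge0.
have aa' i : a i = 0 -> a' i = 0.
  by rewrite /a' => ai; case: eqP => [ii|_]; rewrite ?ai ?subr0//;
    move: ai0; rewrite -ii ai eqxx.
have bb' j : b j = 0 -> b' j = 0.
  by rewrite /b' => bj; case: eqP => [jj|_]; rewrite ?bj ?subr0//;
    move: bj0; rewrite -jj bj eqxx.
have sa' (S : {set I}) : \sum_(i in S) a' i = \sum_(i in S) a i - (if i0 \in S then t else 0).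
  by rewrite sumrB sum_point.
have sb' (S : {set J}) : \sum_(j in S) b' j = \sum_(j in S) b j - (if j0 \in S then t else 0).
  by rewrite sumrB sum_point.
have hall' (S : {set I}) : \sum_(i in S) a' i <= \sum_(j in neighbours E S) b' j.
  rewrite sa' sb'; have [i0S|i0S] := boolP (i0 \in S).
    have -> : j0 \in neighbours E S by rewrite inE; apply/exists_inP; exists i0.
    by rewrite lerD2r.
  case: ifPn => j0S; rewrite !subr0 // lerBrDr -lerBrDl.
  by apply: tS; rewrite /cond i0S.
have add_edge (w : I -> J -> R) : [/\ forall i j, 0 <= w i j,
    forall i j, ~~ E i j -> w i j = 0,
    forall i, \sum_j w i j = a' i &
    forall j, \sum_i w i j <= b' j] ->
  exists w : I -> J -> R, [/\ forall i j, 0 <= w i j,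
    forall i j, ~~ E i j -> w i j = 0,
    forall i, \sum_j w i j = a i &
    forall j, \sum_i w i j <= b j].
  move=> [w0 wE wa wb].
  exists (fun i j => w i j + (if (i == i0) && (j == j0) then t else 0)); split.
  - by move=> i j; rewrite addr_ge0//; case: ifP.
  - move=> i j nE; rewrite wE// add0r; case: ifP => // /andP[/eqP ii /eqP jj].
    by rewrite ii jj Eij0 in nE.
  - move=> i; rewrite big_split/= wa /a'; case: (i == i0) => /=.
      by rewrite sum_pointT subrK.
    by rewrite big1// !subr0 addr0.
  - move=> j; rewrite big_split/= -lerBrDr (le_trans (wb j))// /b' lerD2l lerN2.
    case: (j == j0) => /=; last by rewrite big1// => i; rewrite andbF.
    by under eq_bigr do rewrite andbT; rewrite sum_pointT.
case: tE => [tE|tE|[S /andP[i0S j0S] tE]].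
- have [|w hw] := IHn a' b' _ a'0 b'0 hall'; last by exact: (add_edge w).
  rewrite -ltnS (leq_trans _ ltn)// -addSn leq_add ?card_support_le//.
  by apply: (@card_support_lt _ _ _ i0) => //; rewrite /a' eqxx tE subrr.
- have [|w hw] := IHn a' b' _ a'0 b'0 hall'; last by exact: (add_edge w).
  rewrite -ltnS (leq_trans _ ltn)// -addnS leq_add ?card_support_le//.
  by apply: (@card_support_lt _ _ _ j0) => //; rewrite /b' eqxx tE subrr.
(* The set S is tight for the reduced weights, so the problem splits. The part
   inside S no longer contains i0, and the part outside no longer contains j0. *)
set N := neighbours E S in j0S tE.
have tight : \sum_(j in N) b' j = \sum_(i in S) a' i.
  by rewrite sa' sb' (negbTE i0S) j0S tE/slack; ring.
have [||||w1 [w10 w1E w1a w1b]] := IHn (fun i => if i \in S then a' i else 0)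
  (fun j => if j \in N then b' j else 0).
- rewrite -ltnS (leq_trans _ ltn)// -addSn leq_add ?card_support_le//.
    apply: (@card_support_lt _ _ _ i0) => //; last by rewrite (negbTE i0S).
    by move=> i /aa' ->; rewrite if_same.
  by move=> i /bb' ->; rewrite if_same.
- by move=> i; case: ifP.
- by move=> i; case: ifP.
- move=> T; rewrite !sum_restrict (le_trans (hall' _))//.
  apply: subset_sum_le => //; rewrite finset.subsetI.
  by rewrite !neighboursS// ?finset.subsetIl ?finset.subsetIr.
have [||||w2 [w20 w2E w2a w2b]] := IHn (fun i => if i \in ~: S then a' i else 0)
  (fun j => if j \in ~: N then b' j else 0).
- rewrite -ltnS (leq_trans _ ltn)// -addnS leq_add ?card_support_le//.
    by move=> i /aa' ->; rewrite if_same.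
  apply: (@card_support_lt _ _ _ j0) => //; last by rewrite inE j0S.
  by move=> i /bb' ->; rewrite if_same.
- by move=> i; case: ifP.
- by move=> i; case: ifP.
- move=> T; rewrite !sum_restrict.
  have := hall' (T :|: S); rewrite neighboursU.
  rewrite (big_setID S)/= finset.setUC finset.setUK finset.setDUl finset.setDv
    finset.set0U finset.setDE.
  rewrite [leRHS](big_setID N)/= finset.setUC finset.setUK finset.setDUl finset.setDv
    finset.set0U finset.setDE.
  by rewrite tight lerD2l.
apply: (add_edge (fun i j => w1 i j + w2 i j)); split.
- by move=> i j; rewrite addr_ge0.
- by move=> i j nE; rewrite w1E// w2E// addr0.
- by move=> i; rewrite big_split/= w1a w2a inE; case: (i \in S); rewrite ?addr0 ?add0r.
- move=> j; rewrite big_split/= (le_trans (lerD (w1b j) (w2b j)))// finset.in_setC.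
  by case: (j \in N); rewrite ?addr0 ?add0r.
Qed.

(** Hall's condition may fail by [eps] if mass [eps] is allowed to travel along
    non-edges. The defect is absorbed by an extra target of weight [eps] that is
    adjacent to every source; what is shipped there is afterwards redistributed
    over the unused capacities of the true targets as a product measure. *)
Lemma deficient_transport (I J : finType) (E : I -> J -> bool)
    (a : I -> R) (b : J -> R) (eps : R) :
  (forall i, 0 <= a i) -> (forall j, 0 <= b j) -> 0 <= eps ->
  \sum_i a i = \sum_j b j ->
  (forall S : {set I},
     \sum_(i in S) a i <= \sum_(j in neighbours E S) b j + eps) ->
  exists w : I -> J -> R, [/\ forall i j, 0 <= w i j,
    forall i, \sum_j w i j = a i,
    forall j, \sum_i w i j = b j &
    \sum_i \sum_(j | ~~ E i j) w i j <= eps].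
Proof.
move=> a0 b0 eps0 ab hall.
pose E' i (j : option J) := if j is Some j then E i j else true.
pose b' (j : option J) := if j is Some j then b j else eps.
have sum_option (F : option J -> R) :
    \sum_j F j = F None + \sum_j F (Some j).
  rewrite (bigD1 None)//=; congr (_ + _).
  rewrite (reindex_omap Some id)/=; last by case.
  by apply: eq_bigl => j; rewrite eqxx.
have [|||u [u0 uE ua ub]] := @fractional_hall I (option J) E' a b' => //.
- by case.
- move=> S; have [->|[i iS]] := set_0Vmem S.
    by rewrite big_set0; apply: sumr_ge0 => -[j|] _ /=.
  have -> : neighbours E' S = [set j | if j is Some j then j \in neighbours E S else true].
    apply/finset.setP => -[j|]; rewrite !inE; last by apply/exists_inP; exists i.
    by apply: eq_existsb.
  rewrite [leRHS]big_mkcond sum_option inE/= addrC.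
  rewrite (le_trans (hall S))// lerD2r big_mkcond/=.
  by apply: ler_sum => j _; rewrite [in leRHS]inE.
pose p i := u i None.
pose q j := b j - \sum_i u i (Some j).
pose m := \sum_i p i.
have p0 i : 0 <= p i by exact: u0.
have q0 j : 0 <= q j by rewrite subr_ge0; exact: (ub (Some j)).
have pE i : p i = a i - \sum_j u i (Some j) by rewrite -ua sum_option addrK.
have mq : m = \sum_j q j.
  rewrite /m (eq_bigr _ (fun i _ => pE i)) !sumrB ab; congr (_ - _).
  exact: exchange_big.
have m0 : 0 <= m by exact: sumr_ge0.
have meps : m <= eps by exact: (ub None).
(* If [m = 0] then [p] and [q] vanish, so dividing by [m] is harmless. *)
have pm i : p i * (m / m) = p i.
  have [/eqP m_eq0|m_neq0] := boolP (m == 0); last by rewrite divff// mulr1.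
  move/eqP: (m_eq0); rewrite /m psumr_eq0// => /allP/(_ i).
  by rewrite mem_index_enum => /(_ isT)/eqP ->; rewrite mul0r.
have qm j : q j * (m / m) = q j.
  have [/eqP m_eq0|m_neq0] := boolP (m == 0); last by rewrite divff// mulr1.
  move/eqP: (m_eq0); rewrite mq psumr_eq0// => /allP/(_ j).
  by rewrite mem_index_enum => /(_ isT)/eqP ->; rewrite mul0r.
have w0 i j : 0 <= p i * q j / m by rewrite divr_ge0// mulr_ge0.
exists (fun i j => u i (Some j) + p i * q j / m); split.
- by move=> i j; rewrite addr_ge0.
- move=> i; rewrite big_split/= -mulr_suml -mulr_sumr -mq -mulrA pm pE.
  by rewrite addrC subrK.
- move=> j; rewrite big_split/= -!mulr_suml -/m (mulrC m) -mulrA qm.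
  by rewrite addrC subrK.
- apply: (@le_trans _ _ (\sum_i p i)) => //; apply: ler_sum => i _.
  rewrite (eq_bigr (fun j => p i * q j / m)); last first.
    by move=> j nE; rewrite uE// add0r.
  rewrite -[leRHS]pm mulrA -mulr_suml -mulr_sumr ler_wpM2r ?invr_ge0//.
  rewrite ler_wpM2l// mq [leRHS](bigID (fun j => ~~ E i j))/= lerDl.
  exact: sumr_ge0.
Qed.

End transport.

Local Open Scope classical_set_scope.

(** * Couplings of probability measures *)

Section gluing.
Local Open Scope ereal_scope.
Variable R : realType.

(** A finite Borel partition is encoded as a labelling [l] with values in a
    finite type; its cells are the fibres, so that they are disjoint and cover
    the space by construction. *)
Lemma measure_labels d (T : measurableType d) (mu : {measure set T -> \bar R})
    (I : finType) (l : T -> I) (A : set T) (S : {set I}) :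
  (forall i, measurable (l @^-1` [set i])) -> measurable A ->
  mu (A `&` [set x | l x \in S]) = \sum_(i in S) mu (A `&` l @^-1` [set i]).
Proof.
move=> ml mA; rewrite -[RHS]big_enum/=.
have -> : [set x | l x \in S] = [set x | l x \in enum S].
  by apply/seteqP; split => x /=; rewrite mem_enum.
elim: (enum S) (enum_uniq S) => [_|i s IHs /= /andP[si us]].
  rewrite big_nil (_ : _ `&` _ = set0) ?measure0//.
  by apply/seteqP; split => x //= [].
rewrite big_cons -IHs// -measureU.
- congr (mu _); rewrite -setIUr; congr (_ `&` _).
  apply/seteqP; split => x /=; rewrite inE.
    by move=> /orP[/eqP|]; [left|right].
  by move=> [->|->]; rewrite ?eqxx ?orbT.
- exact: measurableI.
- apply: measurableI => //; rewrite (_ : [set _ | _] = \big[setU/set0]_(j <- s) (l @^-1` [set j])).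
    exact: bigsetU_measurable.
  elim: s {si us IHs} => [|j s IHs]; first by rewrite big_nil; apply/seteqP; split.
  rewrite big_cons -IHs; apply/seteqP; split => x /=; rewrite inE.
    by move=> /orP[/eqP|]; [left|right].
  by move=> [->|->]; rewrite ?eqxx ?orbT.
- apply/seteqP; split => x //= [[_ lx] [_]].
  by rewrite lx (negbTE si).
Qed.

Lemma measurable_labels d (T : measurableType d) (I : finType) (l : T -> I)
    (S : {set I}) :
  (forall i, measurable (l @^-1` [set i])) -> measurable [set x | l x \in S].
Proof.
move=> ml.
rewrite (_ : [set _ | _] = \bigcup_(i in [set i | i \in S]) (l @^-1` [set i])).
  exact: fin_bigcup_measurable.
by apply/seteqP; split => [x ?|x [i /= ? ->//]]; exists (l x).
Qed.

Lemma sum_labels d (T : measurableType d) (P : probability T R)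
    (I : finType) (l : T -> I) (S : {set I}) :
  (forall i, measurable (l @^-1` [set i])) ->
  (\sum_(i in S) fine (P (l @^-1` [set i])))%:E = P [set x | l x \in S].
Proof.
move=> ml; rewrite -[[set x | _]]setTI measure_labels// -sumEFin.
by apply: eq_bigr => i _; rewrite setTI fineK// fin_num_measure.
Qed.

Lemma measure_labelsT d (T : measurableType d) (mu : {measure set T -> \bar R})
    (I : finType) (l : T -> I) (A : set T) :
  (forall i, measurable (l @^-1` [set i])) -> measurable A ->
  mu A = \sum_i mu (A `&` l @^-1` [set i]).
Proof.
move=> ml mA; have := measure_labels mu [set: I] ml mA.
rewrite (_ : [set x | _] = setT) ?setIT => [->|].
  by apply: eq_bigl => i; rewrite inE.
by apply/seteqP; split => x //= _; rewrite inE.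
Qed.

(** The coupling has density [w i j / (P1 cell_i * P2 cell_j)] with respect to
    the product measure on the pair of cells [(i, j)]. Where a cell is null the
    row or column of [w] vanishes, so that the convention [0^-1 = 0] gives the
    right value. *)
Lemma glue_marginals d1 d2 (T1 : measurableType d1) (T2 : measurableType d2)
    (P1 : probability T1 R) (P2 : probability T2 R)
    (I J : finType) (l1 : T1 -> I) (l2 : T2 -> J) (w : I -> J -> R) :
  (forall i, measurable (l1 @^-1` [set i])) ->
  (forall j, measurable (l2 @^-1` [set j])) ->
  (forall i j, 0 <= w i j)%R ->
  (forall i, (\sum_j w i j)%:E = P1 (l1 @^-1` [set i]))%R ->
  (forall j, (\sum_i w i j)%:E = P2 (l2 @^-1` [set j]))%R ->
  exists pi : probability (T1 * T2)%type R,
    [/\ forall A, measurable A -> pi (A `*` setT) = P1 A,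
        forall A, measurable A -> pi (setT `*` A) = P2 A &
        forall i j, pi (l1 @^-1` [set i] `*` l2 @^-1` [set j]) = (w i j)%:E].
Proof.
move=> ml1 ml2 w0 w1 w2.
pose a i := (\sum_j w i j)%R; pose b j := (\sum_i w i j)%R.
have a0 i : (0 <= a i)%R by exact: sumr_ge0.
have b0 j : (0 <= b j)%R by exact: sumr_ge0.
have wa i j : a i = 0%R -> w i j = 0%R.
  move/eqP; rewrite psumr_eq0// => /allP/(_ j).
  by rewrite mem_index_enum => /(_ isT)/eqP.
have wb i j : b j = 0%R -> w i j = 0%R.
  move/eqP; rewrite psumr_eq0// => /allP/(_ i).
  by rewrite mem_index_enum => /(_ isT)/eqP.
have c0 i j : (0 <= w i j / (a i * b j))%R by rewrite divr_ge0// mulr_ge0.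
have mR i j : measurable (l1 @^-1` [set i] `*` l2 @^-1` [set j]) by exact: measurableX.
pose m0 (i : I) (j : J) : {measure set (T1 * T2) -> \bar R} :=
  mscale (NngNum (c0 i j)) (mrestr (P1 \x P2) (mR i j)).
pose m k : {measure set (T1 * T2) -> \bar R} :=
  if insub k is Some k' then let ij := enum_val (k' : 'I_#|{: I * J}|) in m0 ij.1 ij.2
  else mzero.
pose rho := msum m #|{: I * J}|.
have rhoE A B : measurable A -> measurable B -> rho (A `*` B) =
    \sum_i \sum_j (w i j / (a i * b j))%:E *
      (P1 (A `&` l1 @^-1` [set i]) * P2 (B `&` l2 @^-1` [set j])).
  move=> mA mB; rewrite pair_bigA/= (reindex (@enum_val _ {: I * J})); last first.
    exact/onW_bij/enum_val_bij.
  apply: eq_bigr => k _; rewrite /m insubT//= => ltk.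
  rewrite /m0 /mscale/= /mrestr -setXI product_measure1E//; try exact: measurableI.
  by have -> : Sub (val k) ltk = k by exact: val_inj.
have fE1 A : measurable A -> P1 A = (fine (P1 A))%:E by move=> ?; rewrite fineK// fin_num_measure.
have fE2 A : measurable A -> P2 A = (fine (P2 A))%:E by move=> ?; rewrite fineK// fin_num_measure.
have rho1 A : measurable A -> rho (A `*` setT) = P1 A.
  move=> mA; rewrite rhoE// (measure_labelsT _ ml1)//; apply: eq_bigr => i _.
  have mAi : measurable (A `&` l1 @^-1` [set i]) by exact: measurableI.
  have Ai : (fine (P1 (A `&` l1 @^-1` [set i])) <= a i)%R.
    by rewrite -lee_fin -fE1// w1; apply: le_measure; rewrite ?inE.
  rewrite fE1// [RHS]fE1//; move: Ai (fine_ge0 (measure_ge0 P1 (A `&` l1 @^-1` [set i]))).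
  set p := fine _ => pa p0.
  under eq_bigr do rewrite setTI -w2 -!EFinM.
  rewrite sumEFin; congr EFin.
  rewrite (eq_bigr (fun j => w i j * (p / a i)))%R => [|j _].
    rewrite -mulr_suml -/(a i) mulrC.
    have [ai|ai] := eqVneq (a i) 0%R; last by rewrite divfK.
    by move: pa; rewrite ai mulr0 => pa; apply/esym/le_anti; rewrite p0 pa.
  rewrite -/(b j).
  have [ai|ai] := eqVneq (a i) 0%R; first by rewrite wa// !mul0r.
  have [bj|bj] := eqVneq (b j) 0%R; first by rewrite wb// !mul0r.
  by field; rewrite ai bj.
have rho2 A : measurable A -> rho (setT `*` A) = P2 A.
  move=> mA; rewrite rhoE// exchange_big (measure_labelsT _ ml2)//=; apply: eq_bigr => j _.
  have mAj : measurable (A `&` l2 @^-1` [set j]) by exact: measurableI.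
  have Aj : (fine (P2 (A `&` l2 @^-1` [set j])) <= b j)%R.
    by rewrite -lee_fin -fE2// w2; apply: le_measure; rewrite ?inE.
  rewrite [RHS]fE2//; move: Aj (fine_ge0 (measure_ge0 P2 (A `&` l2 @^-1` [set j]))).
  set p := fine _ => pb p0.
  under eq_bigr do rewrite setTI -w1 (fE2 _ mAj) -/p -!EFinM.
  rewrite sumEFin; congr EFin.
  rewrite (eq_bigr (fun i => w i j * (p / b j)))%R => [|i _].
    rewrite -mulr_suml -/(b j) mulrC.
    have [bj|bj] := eqVneq (b j) 0%R; last by rewrite divfK.
    by move: pb; rewrite bj mulr0 => pb; apply/esym/le_anti; rewrite p0 pb.
  rewrite -/(a i).
  have [ai|ai] := eqVneq (a i) 0%R; first by rewrite wa// !mul0r.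
  have [bj|bj] := eqVneq (b j) 0%R; first by rewrite wb// !mul0r.
  by field; rewrite ai bj.
have rhoT : rho setT = 1 by rewrite -setXTT rho1// probability_setT.
pose pi : probability (T1 * T2)%type R :=
  HB.pack rho (@Measure_isProbability.Build _ _ _ rho rhoT).
exists pi; split => // i j; rewrite [LHS]rhoE//.
rewrite (bigD1 i)//= (bigD1 j)//= !setIid [X in _ + X]big1 => [|i' ii'].
  rewrite [X in _ + X + _]big1 => [|j' jj'].
    rewrite !adde0 -w1 -w2 -!EFinM -/(a i) -/(b j); congr EFin.
    have [ai|ai] := eqVneq (a i) 0%R; first by rewrite wa// !mul0r.
    have [bj|bj] := eqVneq (b j) 0%R; first by rewrite wb// !mul0r.
    by field; rewrite ai bj.
  rewrite (_ : l2 @^-1` [set j] `&` _ = set0) ?measure0 ?mule0//.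
  apply/seteqP; split => x //= [-> jj]; by rewrite jj eqxx in jj'.
rewrite big1// => j' _.
rewrite (_ : l1 @^-1` [set i] `&` _ = set0) ?measure0 ?mul0e ?mule0//.
by apply/seteqP; split => x //= [-> ii]; rewrite ii eqxx in ii'.
Qed.

End gluing.

(** * Borel maps into separable metric spaces *)

Section borel_metric.
Variable R : realType.

Lemma open_metric_ball (X : metricType R) (x : X) (r : R) :
  open [set y | mdist x y < r].
Proof.
rewrite openE => y /= xyr; apply/nbhs_ballP.
exists (r - mdist x y) => /=; first by rewrite subr_gt0.
move=> z; rewrite ballEmdist/= ltrBrDl.
exact: le_lt_trans (metric_triangle _ _ _).
Qed.

Lemma open_metric_ballP (X : metricType R) (G : set X) (x : X) :
  open G -> G x -> exists2 r : R, 0 < r & [set y | mdist x y < r] `<=` G.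
Proof.
rewrite openE => Go /Go/nbhs_ballP[r/= r0 rG]; exists r => // y xyr.
by apply: rG; rewrite ballEmdist.
Qed.

Lemma isometric_continuous (X Y : metricType R) (f : X -> Y) :
  isometric f -> continuous f.
Proof.
move=> isof x; apply/metricType_numDomainType.cvgrPdist_lt => e e0.
apply/nbhs_ballP; exists e => // y; rewrite ballEmdist/=.
by rewrite isof.
Qed.

Lemma measurable_open_borel (X : pmetricType R) (G : set (borel X)) :
  open (G : set X) -> measurable G.
Proof. exact: sub_sigma_algebra. Qed.

Lemma continuous_borel (X Y : pmetricType R) (f : X -> Y) :
  continuous f -> measurable_fun setT (f : borel X -> borel Y).
Proof.
move=> /continuousP cf; apply: (@measurability _ _ (borel X) (borel Y) setT f (@open Y)) => //.
move=> _ [G Gopen <-]; rewrite setTI.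
by apply: measurable_open_borel; exact: cf.
Qed.

(** Density in terms of the metric, for a sequence that may repeat points. *)
Definition dense_sequence (X : metricType R) (q : nat -> X) :=
  forall x (e : R), 0 < e -> exists k, mdist (q k) x < e.

Lemma separable_dense_sequence (X : pmetricType R) :
  separable X -> exists q : nat -> X, dense_sequence q.
Proof.
move=> [D [/countable_injP[f injf] denseD]].
exists (fun n => xget point [set x | D x /\ f x = n]) => x e e0.
have [|y [/= xye Dy]] := denseD [set y | mdist x y < e] _ (open_metric_ball _ _).
  by exists x; rewrite /= mdistxx.
exists (f y); case: xgetP => [z -> [Dz fzy]|/(_ y) []//].
by rewrite (injf _ _ _ _ fzy) ?inE// metric_sym.
Qed.

Lemma natSinv_lt (e : R) : 0 < e -> exists n, n.+1%:R^-1 < e.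
Proof.
move=> e0; exists (Num.truncn e^-1).
by rewrite invf_plt ?posrE// truncnS_gt.
Qed.

(** In a separable space an open set is a countable union of balls with centres
    in a dense sequence, so measurability can be tested on balls. *)
Lemma measurable_fun_metric d (T : measurableType d) (X : pmetricType R)
    (f : T -> X) : separable X ->
  (forall x r, measurable [set t | mdist x (f t) < r]) ->
  measurable_fun setT (f : T -> borel X).
Proof.
move=> /separable_dense_sequence[q denseq] mf.
apply: (@measurability _ _ T (borel X) setT f (@open X)) => //.
move=> _ [G Gopen <-]; rewrite setTI.
pose B k n := [set y | mdist (q k) y < n.+1%:R^-1 :> R].
suff -> : f @^-1` G = \bigcup_k \bigcup_(n in [set n | B k n `<=` G]) f @^-1` B k n.
  by apply: bigcupT_measurable => k; apply: bigcup_measurable => n _; exact: mf.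
apply/seteqP; split => t; last by move=> [k _ [n /= BG Bt]]; exact: BG.
move=> /= /(open_metric_ballP Gopen)[r r0 rG].
have [n nr] := natSinv_lt (divr_gt0 r0 (ltr0n R 2)).
have [k kn] := denseq (f t) n.+1%:R^-1 ltac:(by []).
exists k => //; exists n => // y qy; apply: rG => /=.
rewrite (le_lt_trans (metric_triangle _ (q k) _))// (splitr r) ltrD//.
  by rewrite metric_sym (lt_trans kn).
exact: lt_trans nr.
Qed.

(** The distance to a fixed point is continuous, which reduces the claim to
    pointwise limits of real functions. *)
Lemma measurable_fun_metric_lim d (T : measurableType d) (X : pmetricType R)
    (g : nat -> T -> X) (f : T -> X) : separable X ->
  (forall n, measurable_fun setT (g n : T -> borel X)) ->
  (forall t, g ^~ t @ \oo --> f t) ->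
  measurable_fun setT (f : T -> borel X).
Proof.
move=> sepX mg gf; apply: measurable_fun_metric => // x r.
suff mdf : measurable_fun setT (fun t => mdist x (f t)).
  rewrite (_ : [set _ | _] = setT `&` (fun t => mdist x (f t)) @^-1` `]-oo, r[).
    by apply: mdf => //; exact: measurable_itv.
  by rewrite setTI; apply/seteqP; split => t /=; rewrite in_itv.
apply: (@measurable_fun_cvg _ _ _ _ (fun n t => mdist x (g n t))).
  move=> n; apply: (measurability _ (RGenInftyO.measurableE R)) => //.
  move=> _ [_ [s ->] <-].
  rewrite (_ : _ @^-1` _ = g n @^-1` [set y | mdist x y < s]).
    by apply: mg => //; apply: measurable_open_borel; exact: open_metric_ball.
  by apply/seteqP; split => t /=; rewrite in_itv.
move=> t _; apply/cvgrPdist_lt => e e0.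
have /metricType_numDomainType.cvgrPdist_lt/(_ _ e0) := gf t.
apply: filterS => n; apply: le_lt_trans.
have := metric_triangle x (f t) (g n t); have := metric_triangle x (g n t) (f t).
rewrite (metric_sym (g n t) (f t)) ler_norml; lra.
Qed.

End borel_metric.

Section decoding.
Variables (R : realType) (X : completeMetricType R).

Lemma geometric_cvg (u : nat -> X) :
  (forall n, mdist (u n) (u n.+1) < 2 / 2 ^+ n :> R) -> cvgn u.
Proof.
move=> uu.
have tail n m : mdist (u n) (u (n + m)%N) <= 4 * ((2 ^+ n)^-1 - (2 ^+ (n + m)%N)^-1).
  elim: m => [|m IHm]; first by rewrite addn0 mdistxx subrr mulr0.
  rewrite addnS (le_trans (metric_triangle _ (u (n + m)%N) _))//.
  have := uu (n + m)%N; rewrite exprS invfM; move: IHm.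
  set a := mdist _ _; set b := mdist _ _; set e := (2 ^+ (n + m)%N)^-1; lra.
apply/cauchy_cvgP/cauchy_exP => e e0.
have [n _ /(_ n (leqnn _)) ne] :=
  @near_infty_natSinv_expn_lt R (PosNum (divr_gt0 e0 (ltr0n R 4))).
exists (u n); exists n => // m /= nm.
rewrite ballEmdist/= -(subnKC nm) (le_lt_trans (tail _ _))//.
have : 0 < (2 ^+ (n + (m - n))%N)^-1 :> R by rewrite invr_gt0 exprn_gt0.
by move: ne => /=; rewrite div1r; lra.
Qed.

(** The sets [B n k] are to be thought of as the questions: is the encoded point
    in the ball of radius [2^-n] around [q k]? Where the answers do come from a
    point [x], the first centre [q k] that is hit at level [n] is
    [2^-n]-close to [x]. To make the limit exist everywhere, the sequence of
    centres is frozen whenever the next jump would be too large; the modified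
    sequence is always Cauchy and is unchanged where the answers are
    consistent. *)
Lemma decode d (T : measurableType d) (q : nat -> X)
    (B : nat -> nat -> set T) :
  separable X -> dense_sequence q -> (forall n k, measurable (B n k)) ->
  exists2 f : T -> X, measurable_fun setT (f : T -> borel X) &
    forall t x, (forall n k, B n k t <-> mdist (q k) x < (2 ^+ n)^-1) ->
    f t = x.
Proof.
move=> sepX denseq mB.
pose hit n t k := `[< B n k t >].
pose first n t := if pselect (exists k, hit n t k) is left h then ex_minn h else 0%N.
(* The index moves to the first hit of the next level only if that is a small
   jump; the bound leaves room for two points close to a common one. *)
pose step n i j := if mdist (q i) (q j) < 2 / 2 ^+ n then j else i.
pose fix idx (n : nat) (t : T) {struct n} : nat :=
  if n is n'.+1 then step n' (idx n' t) (first n t) else first 0%N t.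
have near n t : mdist (q (idx n t)) (q (idx n.+1 t)) < 2 / 2 ^+ n.
  rewrite /= /step; case: ifP => // _.
  by rewrite mdistxx divr_gt0// exprn_gt0.
have mnat (i : T -> nat) : (forall k, measurable [set t | i t = k]) ->
    forall A : set nat, measurable [set t | A (i t)].
  move=> mi A; rewrite (_ : [set _ | _] = \bigcup_(k in A) [set t | i t = k]).
    by apply: bigcup_measurable => k _; exact: mi.
  by apply/seteqP; split => [t At|t [k Ak /= ->]//]; exists (i t).
have mfirst n k : measurable [set t | first n t = k].
  rewrite (_ : [set _ | _] = (B n k `\` \bigcup_(j in `I_k) B n j) `|`
      (if k == 0%N then ~` \bigcup_j B n j else set0)).
    apply: measurableU; first by apply: measurableD => //; exact: bigcup_measurable.
    by case: ifP => // _; apply: measurableC; exact: bigcupT_measurable.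
  apply/seteqP; split => t /=; rewrite /first.
    case: pselect => [h|h].
      case: ex_minnP => m /asboolP Bm mmin <-; left; split => // -[j /= jm Bj].
      by have := mmin j (asboolT Bj); rewrite leqNgt jm.
    move=> <-; right; rewrite eqxx => -[j _ Bj]; apply: h; exists j.
    exact: asboolT.
  case: pselect => [h|h].
    case: ex_minnP => m /asboolP Bm mmin [[Bk nB]|].
      apply/eqP; rewrite eqn_leq; apply/andP; split; first exact/mmin/asboolT.
      rewrite leqNgt; apply/negP => mk.
      by apply: nB; exists m.
    by case: ifP => // _; case; exists m.
  case=> [[Bk _]|]; first by exfalso; apply: h; exists k; exact: asboolT.
  by case: eqP.
have midx n k : measurable [set t | idx n t = k].
  elim: n k => [|n IHn] k; first exact: mfirst.
  rewrite (_ : [set _ | _] = \bigcup_i \bigcup_(j in [set j | step n i j = k])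
      ([set t | idx n t = i] `&` [set t | first n.+1 t = j])).
    apply: bigcupT_measurable => i; apply: bigcup_measurable => j _.
    exact: measurableI.
  apply/seteqP; split => t /=.
    by move=> h; exists (idx n t) => //; exists (first n.+1 t).
  by move=> [i _ [j /= h [-> ->]]].
have lim t : cvgn (fun n => q (idx n t)) by apply: geometric_cvg => n; exact: near.
exists (fun t => limn (fun n => q (idx n t))).
  apply: (@measurable_fun_metric_lim _ _ _ _ (fun n t => q (idx n t))) => //.
  move=> n; apply: measurable_fun_metric => // x r.
  by apply: (mnat _ (midx n) [set k | mdist x (q k) < r]).
move=> t x Bx.
have first_near n : mdist (q (first n t)) x < (2 ^+ n)^-1.
  rewrite /first; case: pselect => [h|[]].
    by case: ex_minnP => m /asboolP /Bx.
  have [|k qk] := denseq x (2 ^+ n)^-1; first by rewrite invr_gt0 exprn_gt0.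
  by exists k; apply/asboolP/Bx.
have idx_first n : idx n t = first n t.
  elim: n => [//|n IHn]; rewrite /= IHn /step ifT//.
  rewrite (le_lt_trans (metric_triangle _ x _))//.
  have := first_near n; have := first_near n.+1.
  rewrite exprS invfM (metric_sym (q (first n.+1 t))).
  have : 0 < (2 ^+ n)^-1 :> R by rewrite invr_gt0 exprn_gt0.
  set e := (2 ^+ n)^-1; set a := mdist _ _; set b := mdist _ _; lra.
apply/(cvg_lim (@metric_hausdorff _ X)).
apply/metricType_numDomainType.cvgrPdist_lt => e e0.
have := @near_infty_natSinv_expn_lt R (PosNum e0).
apply: filterS => n /=; rewrite div1r => /(lt_trans _); apply.
by rewrite metric_sym idx_first.
Qed.

End decoding.

(** * Transporting Lebesgue measure on the unit interval *)

Section quantile.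
Variable R : realType.

Lemma measurable_unitI_val :
  measurable_fun setT (@unitI_val R : unit_interval R -> measurableTypeR R).
Proof. by move=> _ B mB; rewrite setTI; exists B => //; rewrite setTI. Qed.

Lemma lebesgueI_le (u : R) : 0 <= u <= 1 ->
  lebesgueI [set s : unit_interval R | unitI_val s <= u] = u%:E.
Proof.
move=> /andP[u0 u1]; rewrite /lebesgueI.
have -> : [set unitI_val s | s in [set s : unit_interval R | unitI_val s <= u]] =
    `[0, u]%classic.
  have -> : [set s : unit_interval R | unitI_val s <= u] =
      @unitI_val R @^-1` [set x | x <= u] by [].
  rewrite image_unitI_val; apply/seteqP; split => x /=; rewrite !in_itv/=.
    by move=> [-> /andP[-> _]].
  by move=> /andP[x0 xu]; rewrite xu x0 (le_trans xu).
rewrite lebesgue_measure_itv/= lte_fin; case: ltgtP u0 => // [|<-] _; last by [].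
by rewrite oppr0 adde0.
Qed.

(** The quantile function [q s] is the least [t >= 0] with [s <= F t], where [F]
    is the distribution function of [c]. Right continuity of [F] gives the
    equivalence of [q s <= t] and [s <= F t] for [t >= 0], so the laws of [q] and
    [c] agree on half-lines. *)
Lemma quantile_transform d (T : measurableType d) (P : probability T R)
    (c : T -> R) (M : R) :
  measurable_fun setT c -> (forall x, 0 <= c x <= M) ->
  exists q : unit_interval R -> R, measurable_fun setT q /\
    forall A : set R, measurable A ->
      lebesgueI (q @^-1` A) = P (c @^-1` A).
Proof.
move=> mc c0M.
pose X : {RV P >-> R} :=
  HB.pack c (@isMeasurableFun.Build _ _ T R c mc).
pose F t := fine (cdf X t : \bar R).
have FE t : cdf X t = (F t)%:E by rewrite fineK// fin_num_measure.
have F_mono s t : s <= t -> F s <= F t.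
  by move=> st; rewrite -lee_fin -!FE; exact: cdf_nondecreasing.
have F0 t : 0 <= F t by rewrite -lee_fin -FE cdf_ge0.
have F1 t : F t <= 1 by rewrite -lee_fin -FE cdf_le1.
have FM : F M = 1.
  rewrite /F /cdf /distribution /pushforward.
  rewrite (_ : _ @^-1` _ = setT) ?probability_setT//.
  by apply/seteqP; split => // x _ /=; rewrite in_itv/=; case/andP: (c0M x).
have F_right a s : F a < s -> exists2 t, a < t & F t < s.
  move=> Fas; have /(_ [set y | (y < s%:E)%E]) := @cdf_right_continuous _ _ _ P X a.
  have : nbhs (cdf X a) [set y | (y < s%:E)%E].
    by apply: open_nbhs_nbhs; split; [exact: open_ereal_lt_ereal|rewrite /= FE lte_fin].
  move=> nb /(_ nb) h; near (a^'+) => t; exists t => //.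
  by rewrite -lte_fin -FE; near: t.
pose V (s : unit_interval R) := [set t | 0 <= t /\ unitI_val s <= F t].
have s01 (s : unit_interval R) : 0 <= unitI_val s <= 1.
  by have := valP s; rewrite in_itv.
have M0 : 0 <= M by have /andP[a b] := c0M point; rewrite (le_trans a b).
have VM s : V s M by split => //; rewrite FM; case/andP: (s01 s).
have Vlb s : has_lbound (V s) by exists 0 => t [].
pose q s := inf (V s).
have q0 s : 0 <= q s by apply: lb_le_inf; [exists M|move=> t []].
have qP s t : (q s <= t) = (0 <= t) && (unitI_val s <= F t).
  apply/idP/andP => [qst|[t0 sFt]]; last by apply: ge_inf.
  split; first exact: le_trans qst.
  rewrite leNgt; apply/negP => /F_right[u tu Fu].
  suff : u <= q s by rewrite leNgt (le_lt_trans qst).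
  apply: lb_le_inf; first by exists M.
  move=> v [v0 sFv]; rewrite leNgt; apply/negP => /ltW/F_mono vu.
  by have := le_lt_trans (le_trans sFv vu) Fu; rewrite ltxx.
have q_leE t : q @^-1` `]-oo, t] =
    if 0 <= t then [set s | unitI_val s <= F t] else set0.
  apply/seteqP; split => s /=; rewrite in_itv/= qP; case: (0 <= t) => //=.
have mq_le t : measurable (q @^-1` `]-oo, t] : set (unit_interval R)).
  rewrite q_leE; case: ifP => // _.
  rewrite (_ : [set _ | _] = setT `&` @unitI_val R @^-1` `]-oo, F t]).
    by apply: measurable_unitI_val => //; exact: measurable_itv.
  by rewrite setTI; apply/seteqP; split => s /=; rewrite in_itv.
have mq : measurable_fun setT (q : unit_interval R -> R).
  apply: (measurability _ (RGenOInfty.measurableE R)).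
  move=> _ [_ [t ->] <-]; rewrite setTI -setCitvl preimage_setC.
  exact: measurableC (mq_le t).
exists q; split => // A mA.
pose Q : {mfun unit_interval R >-> R} :=
  HB.pack q (@isMeasurableFun.Build _ _ (unit_interval R) R q mq).
apply: (@measure_unique _ R R (@RGenOInfty.G R)
  (fun n => `](- n%:R), +oo[%classic) _ _ _ _
  (distribution (@lebesgueI R) Q) (distribution P X)) => //.
- exact: (RGenOInfty.measurableE R).
- move=> _ _ [x ->] [y ->]; exists (Num.max x y).
  apply/seteqP; split => z /=; rewrite !in_itv/= !andbT gt_max.
    by move=> [-> ->].
  by move=> /andP[].
- by move=> n; exists (- n%:R).
- apply/seteqP; split => // x _.
  exists (Num.truncn `|x|).+1 => //=.
  rewrite in_itv/= andbT ltrNl (le_lt_trans _ (Num.Theory.truncnS_gt _))//.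
  by rewrite -normrN ler_norm.
- move=> _ [t ->]; rewrite /distribution/= /pushforward -setCitvl !preimage_setC.
  have mX : measurable (c @^-1` `]-oo, t]).
    by rewrite -[X in measurable X]setTI; apply: (mc) => //; exact: measurable_itv.
  rewrite [LHS](probability_setC _ (mq_le t)) [RHS](probability_setC _ mX); congr (_ - _)%E.
  rewrite [RHS](_ : _ = cdf X t)// FE q_leE; case: ifPn => t0.
    by apply: lebesgueI_le; rewrite F0 F1.
  rewrite measure0 -FE /cdf /distribution/= /pushforward (_ : _ @^-1` _ = set0) ?measure0//.
  apply/seteqP; split => // x /=; rewrite in_itv/= => cxt.
  by move/negP: t0; apply; apply: le_trans cxt; case/andP: (c0M x).
- by move=> n; rewrite (le_lt_trans (probability_le1 _ _)) ?ltry.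
Unshelve. all: by end_near. Qed.

End quantile.

Section base4_code.
Variable R : realType.

(** The number [c x] has [n]-th digit in base 4 equal to 1 if [x] lies in
    [U n] and 0 otherwise. As only the digits 0 and 1 occur, the tail after
    a digit is at most a third of the unit of that digit; hence the integer part
    of [4 ^ n * c x] is odd exactly when [x] lies in [U n]. *)
Lemma base4_code d (T : measurableType d) (U : nat -> set T) :
  (forall n, measurable (U n)) ->
  exists (c : T -> R) (D : nat -> set R),
    [/\ measurable_fun setT c, forall x, 0 <= c x <= 2,
        forall n, measurable (D n) & forall n, c @^-1` D n = U n].
Proof.
move=> mU.
pose S n (x : T) : R := \sum_(k < n) \1_(U k) x / 4 ^+ k.
have SS n x : S n.+1 x = S n x + \1_(U n) x / 4 ^+ n.
  by rewrite /S big_ord_recr.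
have p4 n : 0 < (4 ^+ n)^-1 :> R by rewrite invr_gt0 exprn_gt0.
(* Multiplying by [4 ^ n] the partial sum up to the digit [n] gives an integer
   whose parity is that digit. *)
have SP n x : exists N : nat, odd N = (x \in U n) /\ S n.+1 x = N%:R / 4 ^+ n.
  elim: n => [|n [N [_ SN]]].
    exists (x \in U 0%N); rewrite SS /S big_ord0 add0r expr0 indicE.
    by case: (x \in _).
  exists (4 * N + (x \in U n.+1))%N; split.
    by rewrite oddD oddM/= oddb.
  rewrite SS SN indicE natrD natrM exprS.
  by field; rewrite expf_neq0.
have S_le n m x : S (n + m)%N x <= S n x + 4 / 3 * ((4 ^+ n)^-1 - (4 ^+ (n + m)%N)^-1).
  elim: m => [|m IHm]; first by rewrite addn0 subrr mulr0 addr0.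
  rewrite addnS SS exprS invfM.
  have : \1_(U (n + m)%N) x / 4 ^+ (n + m)%N <= (4 ^+ (n + m)%N)^-1 :> R.
    by rewrite indicE; case: (x \in _); rewrite /= ?mul1r// mul0r ltW.
  by move: IHm; set a := S _ _; set b := S _ _; set e := (4 ^+ _)^-1; lra.
have S_nd x : nondecreasing_seq (S ^~ x).
  apply/nondecreasing_seqP => n; rewrite SS lerDl mulr_ge0 ?indicE // ltW.
have S_ub n m x : S m x <= S n x + 4 / 3 * (4 ^+ n)^-1.
  have [nm|/ltnW mn] := leqP n m.
    rewrite -(subnKC nm) (le_trans (S_le _ _ _))// lerD2l ler_pM2l//.
    by rewrite lerBlDr lerDl ltW.
  by rewrite (le_trans (S_nd x _ _ mn))// lerDl mulr_ge0// ltW.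
have S_cvg x : cvgn (S ^~ x).
  apply: nondecreasing_is_cvgn => //.
  by exists (S 0%N x + 4 / 3 * (4 ^+ 0)^-1) => _ [m _ <-].
pose c x := limn (S ^~ x).
have S_c n x : S n x <= c x by exact: nondecreasing_cvgn_le.
have c_S n x : c x <= S n x + 4 / 3 * (4 ^+ n)^-1.
  by apply: limr_le => //; exact: nearW.
pose D n := \bigcup_(k in [set k | odd k])
  `[(k%:R / 4 ^+ n : R), (k.+1%:R / 4 ^+ n : R)[%classic.
have cSn n x : S n.+1 x <= c x < S n.+1 x + (4 ^+ n)^-1.
  rewrite S_c/= (le_lt_trans (c_S n.+1 x))// ltrD2l exprS invfM.
  by have := p4 n; lra.
exists c, D; split.
- apply: (@measurable_fun_cvg _ _ _ _ S) => [m|x _]; last exact: S_cvg.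
  apply: measurable_sum => k; apply: measurable_funM => //.
- move=> x; have := S_c 0%N x; have := c_S 0%N x.
  by rewrite /S big_ord0 expr0 => h ->; lra.
- by move=> n; apply: bigcup_measurable => k _; exact: measurable_itv.
- move=> n; apply/seteqP; split => x.
    move=> [k /= ok]; rewrite in_itv/= => /andP[kc ck].
    have [N [oN SN]] := SP n x; have /andP[h1 h2] := cSn n x.
    suff kN : k = N by move: ok; rewrite kN oN => /set_mem.
    rewrite SN in h1 h2; apply/eqP; rewrite eqn_leq; apply/andP; split; rewrite -ltnS.
      have := le_lt_trans kc h2; rewrite (_ : _ + _ = N.+1%:R / 4 ^+ n).
        by rewrite ltr_pM2r// ltr_nat.
      by rewrite -[N.+1%:R]natr1 mulrDl mul1r.
    by have := le_lt_trans h1 ck; rewrite ltr_pM2r// ltr_nat.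
  move=> Ux; have [N [oN SN]] := SP n x; have := cSn n x.
  rewrite SN => h; exists N => /=; first by rewrite oN; exact/mem_set.
  by rewrite in_itv/= -[N.+1%:R]natr1 mulrDl mul1r.
Qed.

End base4_code.

(** The code [c] answers the ball questions for both coordinates, and the
    decoded maps [f1], [f2] satisfy [(f1 (c x), f2 (c x)) = x]. Composing them
    with the quantile function of [c] therefore turns Lebesgue measure into the
    law of [c] and then into [pi]. *)
Lemma joint_parametrisation (R : realType) (X1 X2 : completeMetricType R)
    (pi : probability (borel X1 * borel X2)%type R) :
  separable X1 -> separable X2 ->
  exists (phi1 : unit_interval R -> X1) (phi2 : unit_interval R -> X2),
    [/\ measurable_fun setT (phi1 : unit_interval R -> borel X1),
        measurable_fun setT (phi2 : unit_interval R -> borel X2) &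
        forall E : set (borel X1 * borel X2), measurable E ->
          lebesgueI [set s | E (phi1 s, phi2 s)] = pi E].
Proof.
move=> sep1 sep2.
have [q1 dense1] := separable_dense_sequence sep1.
have [q2 dense2] := separable_dense_sequence sep2.
pose U m : set (borel X1 * borel X2) :=
  if @choice.unpickle (bool * (nat * nat))%type m is Some (b, (n, k)) then
    if b then fst @^-1` [set x | mdist (q1 k) x < (2 ^+ n)^-1]
    else snd @^-1` [set x | mdist (q2 k) x < (2 ^+ n)^-1]
  else set0.
have mU m : measurable (U m).
  rewrite /U; case: choice.unpickle => [[b [n k]]|//]; case: b.
    rewrite -[X in measurable X]setTI; apply: measurable_fst => //.
    by apply: measurable_open_borel; exact: open_metric_ball.
  rewrite -[X in measurable X]setTI; apply: measurable_snd => //.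
  by apply: measurable_open_borel; exact: open_metric_ball.
have [c [D [mc c02 mD cD]]] := base4_code R mU.
have [f1 mf1 f1c] := decode sep1 dense1
  (fun n k => mD (choice.pickle (true, (n, k)))).
have [f2 mf2 f2c] := decode sep2 dense2
  (fun n k => mD (choice.pickle (false, (n, k)))).
have [g [mg gE]] := quantile_transform pi mc c02.
have f1E x : f1 (c x) = x.1.
  apply: f1c => n k; rewrite -[D _ _]/((c @^-1` D _) x) cD /U.
  by rewrite choice.pickleK.
have f2E x : f2 (c x) = x.2.
  apply: f2c => n k; rewrite -[D _ _]/((c @^-1` D _) x) cD /U.
  by rewrite choice.pickleK.
exists (f1 \o g), (f2 \o g); split.
- exact: measurableT_comp.
- exact: measurableT_comp.
- move=> E mE.
  pose f t : borel X1 * borel X2 := (f1 t, f2 t).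
  have mf : measurable_fun setT f by exact: measurable_fun_pair.
  rewrite -[LHS]/(lebesgueI (g @^-1` (f @^-1` E))) gE; last first.
    by rewrite -[X in measurable X]setTI; exact: mf.
  congr (pi _); apply/seteqP; split => -[x y] /=;
    by rewrite /f f1E f2E.
Qed.

(** * From the Prohorov distance to parametrisations *)

Section strassen.
Variable R : realType.

(** The cells are the successive differences of balls around a dense sequence;
    finitely many of them carry all but [r] of the mass, and the rest is labelled
    [None]. *)
Lemma small_labels (X : pmetricType R) (P : probability (borel X) R) (r : R) :
  separable X -> 0 < r ->
  exists (n : nat) (l : X -> option 'I_n),
    [/\ forall i, measurable (l @^-1` [set i] : set (borel X)),
        (P (l @^-1` [set None]) <= r%:E)%E &
        forall x y i, l x = Some i -> l y = Some i -> mdist x y < r].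
Proof.
move=> /separable_dense_sequence[q denseq] r0.
pose F n : set (borel X) := \bigcup_(k in `I_n) [set x | mdist (q k) x < r / 2].
have mF n : measurable (F n).
  apply: bigcup_measurable => k _.
  by apply: measurable_open_borel; exact: open_metric_ball.
have Fcover x : exists k, mdist (q k) x < r / 2 by apply: denseq; exact: divr_gt0.
pose lab x := ex_minn (Fcover x).
have labF x n : F n x <-> (lab x < n)%N.
  rewrite /lab; case: ex_minnP => m qm mmin; split; last by exists m.
  by move=> [k /= kn qk]; rewrite (leq_ltn_trans (mmin _ qk)).
have : P (F n) @[n --> \oo] --> P (\bigcup_n F n).
  apply: nondecreasing_cvg_mu => //; first exact: bigcupT_measurable.
  move=> m n mn; apply/subsetPset => x [k /= km ?]; exists k => //=.
  exact: leq_trans mn.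
rewrite (_ : \bigcup_n F n = setT); last first.
  by apply/seteqP; split => // x _; exists (lab x).+1 => //; exact/labF.
rewrite probability_setT => /(_ [set y | ((1 - r)%:E < y)%E]) [].
  apply: open_nbhs_nbhs; split; first exact: open_ereal_gt_ereal.
  by rewrite /= lte_fin gtrBl.
move=> n _ /(_ n (leqnn n))/= Pn.
exists n, (fun x => insub (lab x)); split.
- case=> [i|].
    rewrite (_ : _ @^-1` _ = F i.+1 `\` F i); first exact: measurableD.
    apply/seteqP; split => x /=.
      case: insubP => // j _ jlab [<-]; rewrite jlab.
      by split; [apply/labF|move/labF; rewrite ltnn].
    move=> [/labF]; rewrite ltnS => labi nlab.
    have labE : lab x = i.
      by apply/eqP; rewrite eqn_leq labi leqNgt; apply/negP => /labF.
    by rewrite labE valK.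
  rewrite (_ : _ @^-1` _ = ~` F n); first exact: measurableC.
  apply/seteqP; split => x /=.
    by case: insubP => // /negP nx _ /labF.
  by move=> nF; rewrite insubF//; apply/negP => /labF.
- rewrite (_ : _ @^-1` _ = ~` F n).
    move: Pn; rewrite probability_setC// -(fineK (fin_num_measure P _ (mF n))).
    by rewrite lte_fin -EFinB lee_fin; lra.
  apply/seteqP; split => x /=.
    by case: insubP => // /negP nx _ /labF.
  by move=> nF; rewrite insubF//; apply/negP => /labF.
- move=> x y i; case: insubP => // j _ jx [ji]; case: insubP => // k _ ky [ki].
  have qlab z : mdist (q (lab z)) z < r / 2 by rewrite /lab; case: ex_minnP.
  rewrite (le_lt_trans (metric_triangle _ (q (lab x)) _))// (splitr r) ltrD//.
    by rewrite metric_sym.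
  by rewrite -jx ji -ki ky.
Qed.

Lemma thickenP (Z : metricType R) (A : set Z) (e : R) (z : Z) :
  thicken A e z <-> exists2 a, A a & mdist a z < e.
Proof.
split=> [|[a Aa ae]].
  by move=> /ereal_inf_lt[_ [a Aa <-]]; rewrite lte_fin; exists a.
apply: (@le_lt_trans _ _ (mdist a z)%:E); last by rewrite lte_fin.
by apply: ereal_inf_lbound; exists a.
Qed.

Lemma open_thicken (Z : metricType R) (A : set Z) (e : R) : open (thicken A e).
Proof.
rewrite (_ : thicken A e = \bigcup_(a in A) [set z | mdist a z < e]).
  by apply: bigcup_open => a _; exact: open_metric_ball.
by apply/seteqP; split => z; [move=> /thickenP|move=> h; apply/thickenP].
Qed.

(** The error [r] enters through the diameters of the cells, through the two
    remainders labelled [None], and through the open [r]-neighbourhood [G] that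
    replaces the image of a union of cells, because images of Borel sets need not
    be Borel. *)
Lemma approximate_strassen (X1 X2 : mmspace R) (Z : pmetricType R)
    (f : X1 -> Z) (g : X2 -> Z) (e r : R) :
  isometric f -> isometric g -> 0 < e -> 0 < r ->
  (forall A : set (borel Z), measurable A ->
    (mm_measure X1 (f @^-1` A) <= mm_measure X2 (g @^-1` thicken A e) + e%:E)%E) ->
  exists (phi1 : unit_interval R -> X1) (phi2 : unit_interval R -> X2)
    (A : set (unit_interval R)),
    [/\ parametrisation phi1, parametrisation phi2, measurable A,
        forall s, A s -> mdist (f (phi1 s)) (g (phi2 s)) <= e + 3 * r &
        (lebesgueI (~` A) <= (e + 2 * r)%:E)%E].
Proof.
move=> isof isog e0 r0 prok.
set P1 := mm_measure X1 in prok *; set P2 := mm_measure X2 in prok *.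
have mfcont : measurable_fun setT (f : borel X1 -> borel Z).
  by apply: continuous_borel; exact: isometric_continuous.
have mgcont : measurable_fun setT (g : borel X2 -> borel Z).
  by apply: continuous_borel; exact: isometric_continuous.
have [n1 [l1 [ml1 P1None l1r]]] := small_labels P1 (@mm_separable _ X1) r0.
have [n2 [l2 [ml2 P2None l2r]]] := small_labels P2 (@mm_separable _ X2) r0.
pose E (i : option 'I_n1) (j : option 'I_n2) :=
  `[< exists x y, [/\ l1 x = i, l2 y = j, i <> None, j <> None &
                      mdist (f x) (g y) < e + r] >].
pose a i := fine (P1 (l1 @^-1` [set i])); pose b j := fine (P2 (l2 @^-1` [set j])).
have aE i : (a i)%:E = P1 (l1 @^-1` [set i]) by rewrite fineK// fin_num_measure.
have bE j : (b j)%:E = P2 (l2 @^-1` [set j]) by rewrite fineK// fin_num_measure.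
have hall (S : {set option 'I_n1}) :
    \sum_(i in S) a i <= \sum_(j in neighbours E S) b j + (e + 2 * r).
  pose G : set Z := thicken (f @` [set x | l1 x \in S /\ l1 x <> None]) r.
  have mG : measurable (G : set (borel Z)).
    by apply: measurable_open_borel; exact: open_thicken.
  have mfG : measurable (f @^-1` G : set (borel X1)).
    by rewrite -[X in measurable X]setTI; exact: mfcont.
  have mgG : measurable (g @^-1` thicken G e : set (borel X2)).
    rewrite -[X in measurable X]setTI; apply: mgcont => //.
    by apply: measurable_open_borel; exact: open_thicken.
  have mS := measurable_labels S ml1; have mN := measurable_labels (neighbours E S) ml2.
  rewrite -lee_fin EFinD !sum_labels//.
  apply: (@le_trans _ _ (P1 (f @^-1` G `|` l1 @^-1` [set None]))).
    apply: le_measure; rewrite ?inE//; first exact: measurableU.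
    move=> x /= xS; have [lx|lx] := pselect (l1 x = None); [by right|left].
    by apply/thickenP; exists (f x); [exists x|rewrite mdistxx].
  rewrite (le_trans (measureU2 _ _ _))//.
  apply: (@le_trans _ _ (P2 (g @^-1` thicken G e) + e%:E + r%:E)%E).
    by rewrite leeD//; exact: prok.
  apply: (@le_trans _ _ (P2 ([set y | l2 y \in neighbours E S] `|` l2 @^-1` [set None])
      + e%:E + r%:E)%E).
    rewrite !leeD2r//; apply: le_measure; rewrite ?inE//; first exact: measurableU.
    move=> y /thickenP[z /thickenP[_ [x [xS lx] <-] fxz] zgy].
    have [ly|ly] := pselect (l2 y = None); [by right|left].
    rewrite /= inE; apply/exists_inP; exists (l1 x) => //; apply/asboolP.
    exists x, y; split => //; rewrite (le_lt_trans (metric_triangle _ z _))//.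
    by rewrite addrC ltrD.
  apply: (@le_trans _ _ (P2 [set y | l2 y \in neighbours E S] + r%:E + e%:E + r%:E)%E).
    by rewrite !leeD2r// (le_trans (measureU2 _ _ _))// leeD.
  by rewrite -!addeA leeD2l// -!EFinD lee_fin; lra.
have sum_a : (\sum_i a i)%:E = P1 setT.
  rewrite (measure_labelsT P1 ml1)// -sumEFin.
  by apply: eq_bigr => i _; rewrite setTI.
have sum_b : (\sum_i b i)%:E = P2 setT.
  rewrite (measure_labelsT P2 ml2)// -sumEFin.
  by apply: eq_bigr => i _; rewrite setTI.
have sum_ab : \sum_i a i = \sum_j b j.
  by move: sum_a; rewrite probability_setT -(probability_setT P2) -sum_b => -[].
have [|||||w [w0 wa wb wE]] := @deficient_transport _ _ _ E a b (e + 2 * r).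
- by move=> i; exact: fine_ge0.
- by move=> j; exact: fine_ge0.
- by rewrite addr_ge0// ?mulr_ge0// ltW.
- exact: sum_ab.
- exact: hall.
have [||pi [pi1 pi2 piw]] := @glue_marginals _ _ _ _ _ P1 P2 _ _ l1 l2 w ml1 ml2 w0.
- by move=> i; rewrite wa.
- by move=> j; rewrite wb.
have [phi1 [phi2 [mphi1 mphi2 phiE]]] :=
  joint_parametrisation pi (@mm_separable _ X1) (@mm_separable _ X2).
pose l (x : borel X1 * borel X2) := (l1 x.1, l2 x.2).
have lE i j : l @^-1` [set (i, j)] = l1 @^-1` [set i] `*` l2 @^-1` [set j].
  apply/seteqP; split => -[x y]; first by move=> [lx ly]; split.
  by move=> [lx ly]; congr (_, _).
have ml ij : measurable (l @^-1` [set ij]).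
  by case: ij => i j; rewrite lE; exact: measurableX.
pose N := [set ij | ~~ E ij.1 ij.2]%SET.
have mN : measurable [set x | l x \in N] by exact: measurable_labels.
have mphi : measurable_fun setT (fun s => (phi1 s, phi2 s) : borel X1 * borel X2).
  exact: measurable_fun_pair.
exists phi1, phi2, (~` [set s | l (phi1 s, phi2 s) \in N]); split.
- split=> // A mA; rewrite -pi1// -phiE; last exact: measurableX.
  by congr lebesgueI; apply/seteqP; split => s //= [].
- split=> // A mA; rewrite -pi2// -phiE; last exact: measurableX.
  by congr lebesgueI; apply/seteqP; split => s //= [].
- apply: measurableC; rewrite -[X in measurable X]setTI.
  exact: (mphi measurableT _ mN).
- move=> s /= /negP; rewrite inE/= negbK => /asboolP[x [y [lx ly xN yN xy]]].
  (* The points x and y lie in the same cells as [phi1 s] and [phi2 s]. *)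
  case lxi: (l1 x) lx xN => [i|] lx xN; last by case: xN.
  case lyj: (l2 y) ly yN => [j|] ly yN; last by case: yN.
  have h1 := l1r _ _ _ (esym lx) lxi; have h2 := l2r _ _ _ lyj (esym ly).
  rewrite -isof in h1; rewrite -isog in h2.
  have t1 := metric_triangle (f (phi1 s)) (f x) (g (phi2 s)).
  have t2 := metric_triangle (f x) (g y) (g (phi2 s)).
  move: h1 h2 xy t1 t2; lra.
- rewrite (_ : ~` _ = [set s | [set x | l x \in N] (phi1 s, phi2 s)]); last first.
    by rewrite setCK.
  rewrite phiE//.
  rewrite -[[set x | _]]setTI measure_labels//.
  apply: (@le_trans _ _ (\sum_i \sum_(j | ~~ E i j) w i j)%:E); last by rewrite lee_fin.
  rewrite pair_big_dep/= -sumEFin.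
  rewrite le_eqVlt; apply/orP; left; apply/eqP.
  apply: eq_big => [[i j]|[i j] _]; first by rewrite inE.
  by rewrite setTI lE piw.
Qed.

Lemma gromov_box_le (X1 X2 : mmspace R) (Z : pmetricType R)
    (f : X1 -> Z) (g : X2 -> Z) (e : R) :
  isometric f -> isometric g -> 0 < e ->
  (forall A : set (borel Z), measurable A ->
    (mm_measure X1 (f @^-1` A) <= mm_measure X2 (g @^-1` thicken A e) + e%:E)%E) ->
  (gromov_box 2^-1 X1 X2 <= (2 * e)%:E)%E.
Proof.
move=> isof isog e0 prok; apply/lee_addgt0Pr => d d0.
(* The distortion is at most twice [e + 3 * r], which is [2 * e + d]. *)
pose r := d / 6; have r0 : 0 < r by exact: divr_gt0.
have [phi1 [phi2 [A [par1 par2 mA dA lA]]]] :=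
  approximate_strassen isof isog e0 r0 prok.
apply: (@le_trans _ _ (box (@lebesgueI R) 2^-1 (pullback_dist phi1) (pullback_dist phi2))).
  by apply: ereal_inf_lbound; exists phi1, phi2.
apply: ereal_inf_lbound; rewrite -EFinD; exists (2 * e + d) => //; split.
  by rewrite addr_gt0// mulr_gt0.
exists A; split => //.
- apply: ge_ereal_sup => _ [s As [t At <-]].
  rewrite lee_fin /pullback_dist -(isof (phi1 s)) -(isog (phi2 s)).
  have hs := dA _ As; have ht := dA _ At.
  rewrite ler_norml.
  have t1 := metric_triangle (f (phi1 s)) (g (phi2 s)) (f (phi1 t)).
  have t2 := metric_triangle (g (phi2 s)) (g (phi2 t)) (f (phi1 t)).
  have t3 := metric_triangle (g (phi2 s)) (f (phi1 s)) (g (phi2 t)).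
  have t4 := metric_triangle (f (phi1 s)) (f (phi1 t)) (g (phi2 t)).
  rewrite (metric_sym (g (phi2 t))) in t2; rewrite (metric_sym (g (phi2 s)) (f _)) in t3.
  move: hs ht t1 t2 t3 t4; rewrite /r; lra.
- rewrite (le_trans lA)// lee_fin /r; move: d0; lra.
Qed.

End strassen.

(** * From parametrisations to a common metric space *)

Section glued.
Variable R : realType.

Section glued_dist.
Variables (X1 X2 : metricType R) (I : Type) (A : set I).
Variables (phi1 : I -> X1) (phi2 : I -> X2) (h : R).

(** The infimum of the lengths of the paths from [x] to [y] over a bridge of
    length [h] that joins [phi1 s] to [phi2 s] for some [s] in [A]. *)
Definition bridge (x : X1) (y : X2) : R :=
  inf [set mdist x (phi1 s) + mdist (phi2 s) y | s in A] + h.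

Definition glued_dist (u v : X1 + X2) : R :=
  match u, v with
  | inl x, inl x' => mdist x x'
  | inr y, inr y' => mdist y y'
  | inl x, inr y | inr y, inl x => bridge x y
  end.

Hypothesis A0 : A !=set0.
Hypothesis h0 : 0 < h.
Hypothesis distortion : forall s t, A s -> A t ->
  `|mdist (phi1 s) (phi1 t) - mdist (phi2 s) (phi2 t)| <= 2 * h.

Lemma bridge_le x y s : A s ->
  bridge x y <= mdist x (phi1 s) + mdist (phi2 s) y + h.
Proof.
move=> As; rewrite lerD2r; apply: ge_inf; last by exists s.
by exists 0 => _ [t _ <-]; rewrite addr_ge0// mdist_ge0.
Qed.

Lemma le_bridge x y c :
  (forall s, A s -> c <= mdist x (phi1 s) + mdist (phi2 s) y + h) ->
  c <= bridge x y.
Proof.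
move=> cA; rewrite -lerBlDr; apply: lb_le_inf.
  by have [s As] := A0; exists (mdist x (phi1 s) + mdist (phi2 s) y); exists s.
by move=> _ [s As <-]; rewrite lerBlDr cA.
Qed.

Lemma bridge_gt0 x y : 0 < bridge x y.
Proof.
rewrite (lt_le_trans h0)//; apply: le_bridge => s As.
by rewrite lerDr addr_ge0// mdist_ge0.
Qed.

Lemma bridge_trianglel x x' y : bridge x y <= mdist x x' + bridge x' y.
Proof.
rewrite -lerBlDl; apply: le_bridge => s As.
have := bridge_le x y As; have := metric_triangle x x' (phi1 s); lra.
Qed.

Lemma bridge_triangler x y y' : bridge x y <= bridge x y' + mdist y' y.
Proof.
rewrite -lerBlDr; apply: le_bridge => s As.
have := bridge_le x y As; have := metric_triangle (phi2 s) y' y; lra.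
Qed.

(** The path from [x] over the bridge at [s], then back over the bridge at [t]
    has length at least [mdist x x']: the two bridges cost [2 * h], which pays
    for the difference between the distances of the feet on the two sides. *)
Lemma bridge_dist1 x x' y : mdist x x' <= bridge x y + bridge x' y.
Proof.
rewrite -lerBlDr; apply: le_bridge => s As.
rewrite lerBlDr addrC -lerBlDr; apply: le_bridge => t At.
have := distortion As At; rewrite ler_norml => /andP[_ st].
have := metric_triangle x (phi1 s) x'; have := metric_triangle (phi1 s) (phi1 t) x'.
have := metric_triangle (phi2 s) y (phi2 t).
rewrite (metric_sym (phi1 t) x') (metric_sym y (phi2 t)).
move: st; lra.
Qed.

Lemma bridge_dist2 x y y' : mdist y y' <= bridge x y + bridge x y'.
Proof.
rewrite -lerBlDr; apply: le_bridge => s As.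
rewrite lerBlDr addrC -lerBlDr; apply: le_bridge => t At.
have := distortion As At; rewrite ler_norml => /andP[st _].
have := metric_triangle y (phi2 s) y'; have := metric_triangle (phi2 s) (phi2 t) y'.
have := metric_triangle (phi1 s) x (phi1 t).
rewrite (metric_sym y (phi2 s)) (metric_sym (phi1 s) x).
move: st; lra.
Qed.

Lemma glued_distxx u : glued_dist u u = 0.
Proof. by case: u => x /=; rewrite mdistxx. Qed.

Lemma glued_dist_positivity u v : glued_dist u v = 0 -> u = v.
Proof.
case: u v => [x|y] [x'|y'] /=; try by move=> /mdist_positivity ->.
- by move=> b0; have := bridge_gt0 x y'; rewrite b0 ltxx.
- by move=> b0; have := bridge_gt0 x' y; rewrite b0 ltxx.
Qed.

Lemma glued_dist_sym u v : glued_dist u v = glued_dist v u.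
Proof. by case: u v => [x|y] [x'|y'] //=; rewrite metric_sym. Qed.

Lemma glued_dist_triangle v u w :
  glued_dist u w <= glued_dist u v + glued_dist v w.
Proof.
case: u v w => [x|y] [x'|y'] [x''|y''] /=; do ?exact: metric_triangle.
- exact: bridge_trianglel.
- exact: bridge_dist1.
- exact: bridge_triangler.
- by rewrite addrC metric_sym; exact: bridge_trianglel.
- exact: bridge_dist2.
- by rewrite addrC metric_sym; exact: bridge_triangler.
Qed.

End glued_dist.

Lemma glued_space (X1 X2 : pmetricType R) (I : Type) (A : set I)
    (phi1 : I -> X1) (phi2 : I -> X2) (h : R) :
  A !=set0 -> 0 < h ->
  (forall s t, A s -> A t ->
    `|mdist (phi1 s) (phi1 t) - mdist (phi2 s) (phi2 t)| <= 2 * h) ->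
  exists (Z : pmetricType R) (f : X1 -> Z) (g : X2 -> Z),
    [/\ isometric f, isometric g, range f `|` range g = setT &
      forall s, A s -> mdist (f (phi1 s)) (g (phi2 s)) <= h].
Proof.
move=> A0 h0 dis.
pose met := isMetric.Build R (X1 + X2)%type
  (glued_distxx A phi1 phi2 h)
  (glued_dist_positivity A0 h0)
  (glued_dist_sym A phi1 phi2 h)
  (glued_dist_triangle A0 dis).
pose Z : pmetricType R := HB.pack (X1 + X2)%type met
  (isPointed.Build (X1 + X2)%type (inl point)).
exists Z, inl, inr; split => //.
- by apply/seteqP; split => // -[x|y] _; [left; exists x|right; exists y].
- move=> s As; have := bridge_le phi1 phi2 h (phi1 s) (phi2 s) As.
  by rewrite !mdistxx !add0r.
Qed.

Lemma separable_cover (X1 X2 Z : metricType R) (f : X1 -> Z) (g : X2 -> Z) :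
  separable X1 -> separable X2 -> isometric f -> isometric g ->
  range f `|` range g = setT -> separable Z.
Proof.
move=> [D1 [cD1 dD1]] [D2 [cD2 dD2]] isof isog fg.
exists (f @` D1 `|` g @` D2); split.
  rewrite -bigcup2E; apply: bigcup_countable => // -[|[|n]] _ /=.
  - exact: sub_countable (card_image_le _ _) cD1.
  - exact: sub_countable (card_image_le _ _) cD2.
  - exact: countable0.
move=> O [z Oz] Oo.
have /continuousP cf := isometric_continuous isof.
have /continuousP cg := isometric_continuous isog.
have : [set: Z] z by []; rewrite -fg => -[[x _ xz]|[x _ xz]].
  have [|y [Oy Dy]] := dD1 (f @^-1` O) _ (cf _ Oo); first by exists x; rewrite /= xz.
  by exists (f y); split => //; left; exists y.
have [|y [Oy Dy]] := dD2 (g @^-1` O) _ (cg _ Oo); first by exists x; rewrite /= xz.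
by exists (g y); split => //; right; exists y.
Qed.

Lemma gromov_prohorov_le (X1 X2 : mmspace R)
    (phi1 : unit_interval R -> X1) (phi2 : unit_interval R -> X2)
    (A : set (unit_interval R)) (h : R) :
  parametrisation phi1 -> parametrisation phi2 -> 0 < h -> measurable A ->
  (forall s t, A s -> A t ->
    `|pullback_dist phi1 s t - pullback_dist phi2 s t| <= 2 * h) ->
  (lebesgueI (~` A) <= h%:E)%E ->
  (gromov_prohorov X1 X2 <= h%:E)%E.
Proof.
move=> [mphi1 phi1E] [mphi2 phi2E] h0 mA disA lA.
(* If A is empty then [1 <= h], and A may be replaced by a single point, on
   which the distortion is zero. *)
wlog A0 : A mA disA lA / A !=set0.
  move=> wl; have [A0|/set0P A0] := eqVneq A set0; last exact: (wl A).
  pose B : set (unit_interval R) := [set point].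
  have mB : measurable B.
    rewrite (_ : B = setT `&` @unitI_val R @^-1` [set unitI_val (point : unit_interval R)]).
      by apply: (measurable_unitI_val measurableT).
    by rewrite setTI; apply/seteqP; split => [s ->//|s /val_inj].
  apply: (wl B) => //.
  - by move=> s t -> ->; rewrite /pullback_dist !mdistxx subrr normr0 mulr_ge0// ltW.
  - apply: le_trans lA; rewrite A0 setC0; apply: le_measure; rewrite ?inE//.
    exact: measurableC.
  - by exists point.
have [Z [f [g [isof isog fg fgA]]]] := glued_space A0 h0 disA.
have sepZ := separable_cover (@mm_separable _ X1) (@mm_separable _ X2) isof isog fg.
have mfcont : measurable_fun setT (f : borel X1 -> borel Z).
  by apply: continuous_borel; exact: isometric_continuous.
have mgcont : measurable_fun setT (g : borel X2 -> borel Z).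
  by apply: continuous_borel; exact: isometric_continuous.
apply: le_trans (_ : prohorov (pushforward (mm_measure X1) (f : borel X1 -> borel Z))
                   (pushforward (mm_measure X2) (g : borel X2 -> borel Z)) <= _)%E.
  by apply: ereal_inf_lbound; exists Z, f, g.
(* Thickenings are open: closeness up to [h] only gives membership in the
   thickenings of radius larger than [h]. *)
apply/lee_addgt0Pr => d d0; rewrite -EFinD.
apply: ereal_inf_lbound; exists (h + d) => //; split; first exact: addr_gt0.
move=> B mB; rewrite /pushforward.
have mfB : measurable (f @^-1` B : set (borel X1)).
  by rewrite -[X in measurable X]setTI; exact: mfcont.
have mgB : measurable (g @^-1` thicken B (h + d) : set (borel X2)).
  rewrite -[X in measurable X]setTI; apply: mgcont => //.
  by apply: measurable_open_borel; exact: open_thicken.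
rewrite -phi1E// -phi2E// /pushforward.
set S1 := phi1 @^-1` _; set S2 := phi2 @^-1` _.
have mS1 : measurable S1 by rewrite -[X in measurable X]setTI; exact: mphi1.
have mS2 : measurable S2 by rewrite -[X in measurable X]setTI; exact: mphi2.
apply: (@le_trans _ _ (lebesgueI (S2 `|` ~` A))).
  apply: le_measure; rewrite ?inE//.
    by apply: measurableU => //; exact: measurableC.
  move=> s S1s; have [As|nAs] := pselect (A s); [left|by right].
  apply/thickenP; exists (f (phi1 s)) => //.
  by rewrite (le_lt_trans (fgA _ As))// ltrDl.
rewrite (le_trans (measureU2 _ _ _))//; first exact: measurableC.
by rewrite leeD2l// (le_trans lA)// lee_fin lerDl ltW.
Qed.

End glued.

Local Close Scope classical_set_scope.

Theorem theorem3p1 (R : realType) (X1 X2 : mmspace R) :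
  gromov_prohorov X1 X2 = ((2^-1)%:E * gromov_box 2^-1 X1 X2)%E.
Proof.
apply/le_anti/andP; split.
- rewrite lee_pdivlMl//.
  apply: le_ereal_inf_tmp => _ [phi1 [phi2 [par1 par2 ->]]].
  apply: le_ereal_inf_tmp => _ [e [e0 [A [mA disA lA]]] <-].
  rewrite -lee_pdivlMl// -EFinM.
  apply: (gromov_prohorov_le par1 par2 _ mA) => //.
  + by rewrite mulr_gt0.
  + move=> s t As At; rewrite mulrA divff// mul1r -lee_fin.
    by apply: le_trans disA; apply: ereal_sup_ubound; exists s => //; exists t.
- apply: le_ereal_inf_tmp => _ [Z [f [g [_ isof isog ->]]]].
  apply: le_ereal_inf_tmp => _ [e [e0 prok] <-].
  by rewrite lee_pdivrMl//; exact: gromov_box_le prok.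
Qed.
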